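(* Let $A$ be a unital $C^{\ast}$-algebra with unit $1$, let $a \in A$ with $0 \le a \le 1$, and let $p$ be a projection in $A$. Then the following statements are equivalent: (1) $a$ is absolutely compatible with $p$, that is, $|a-p| + |a+p-1| = 1$; (2) $a \dot\wedge p = ap$; (3) $ap = pa$. In this case, $\inf\{a,p\}$ exists in $A^+$ and is equal to $a \dot\wedge p$.
   Context: A projection is a self-adjoint idempotent. $A^+$ is the cone of positive elements, with the usual order on self-adjoint elements. For $x \in A$, $|x| := (x^{\ast}x)^{1/2}$. For self-adjoint $a,b$, $a \dot\wedge b := \frac12 (a + b - |a - b|)$. Elements $a,b\in[0,1]$ are absolutely compatible if $|a-b|+|a+b-1|=1$. $\inf\{a,p\}$ in $A^+$ is the greatest element of $\{x\in A^+ : x\le a,\ x\le p\}$. *)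

(* Defs.v *)
From HB Require Import structures.
From mathcomp Require Import all_boot all_order all_algebra.
From mathcomp Require Import complex.
From mathcomp Require Import all_classical all_reals all_analysis.

Set Implicit Arguments.
Unset Strict Implicit.
Unset Printing Implicit Defensive.

Import Order.TTheory GRing.Theory Num.Theory.
Import numFieldNormedType.Exports.

Local Open Scope classical_set_scope.
Local Open Scope ring_scope.

(* A submultiplicative norm on an algebra.  Hierarchy-Builder's only join of a
   ring structure with a library norm `|_| is [numDomainType], so an algebra
   cannot also be a [normedModType]: the norm is a field of its own here, with
   the axioms of [Lmodule_isNormed], and the library's norm and topology live on
   the copy [normed_of A] below. *)
HB.mixin Record isNormedAlgebra (K : numFieldType) A of GRing.Algebra K A := {
  anorm : A -> K ;
  ler_anormD : forall x y : A, anorm (x + y) <= anorm x + anorm y ;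
  anormZ : forall (k : K) (x : A), anorm (k *: x) = `|k| * anorm x ;
  anorm0_eq0 : forall x : A, anorm x = 0 -> x = 0 ;
  ler_anormM : forall x y : A, anorm (x * y) <= anorm x * anorm y
}.

#[short(type="normedAlgType")]
HB.structure Definition NormedAlgebra (K : numFieldType) :=
  { A of isNormedAlgebra K A & GRing.Algebra K A }.

Definition normed_of (K : numFieldType) (A : normedAlgType K) : Type := A.

HB.instance Definition _ (K : numFieldType) (A : normedAlgType K) :=
  GRing.Lmodule.copy (normed_of A) A.
HB.instance Definition _ (K : numFieldType) (A : normedAlgType K) :=
  Lmodule_isNormed.Build K (normed_of A) ler_anormD anormZ anorm0_eq0.

(* Over K = R[i] with R : realType, this is a unital C*-algebra.  [algType]
   entails 1 != 0, and anorm 1 = 1 then follows from these axioms. *)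
HB.mixin Record isCStarAlgebra (K : numClosedFieldType) A
    of NormedAlgebra K A := {
  star : A -> A ;
  starK : involutive star ;
  starD : {morph star : x y / x + y} ;
  starZ : forall (k : K) (x : A), star (k *: x) = k^* *: star x ;
  starM : forall x y : A, star (x * y) = star y * star x ;
  cstar_norm : forall x : A, anorm (star x * x) = anorm x ^+ 2 ;
  anorm_complete : forall F : set_system (normed_of A),
    ProperFilter F -> cauchy F -> cvg F
}.

#[short(type="cstarAlgType")]
HB.structure Definition CStarAlgebra (K : numClosedFieldType) :=
  { A of isCStarAlgebra K A & NormedAlgebra K A }.

HB.instance Definition _ (K : numClosedFieldType) (A : cstarAlgType K) :=
  Uniform_isComplete.Build (normed_of A) anorm_complete.

Section CStarDefs.
Context {K : numClosedFieldType} {A : cstarAlgType K}.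
Implicit Types (x y a b p m : A).

Definition self_adjoint x : Prop := star x = x.

Definition projection p : Prop := self_adjoint p /\ p * p = p.

Definition invertible x : Prop := exists y, y * x = 1 /\ x * y = 1.

Definition spectrum x : set K := [set l | ~ invertible (l%:A - x)].

(* In a [numClosedFieldType], 0 <= l says that l is a nonnegative real. *)
Definition cpositive : set A :=
  [set x | self_adjoint x /\ forall l, spectrum x l -> 0 <= l].

Definition cle x y : Prop :=
  [/\ self_adjoint x, self_adjoint y & cpositive (y - x)].

(* The positive square root.  In a unital C*-algebra a positive element has
   exactly one, so the choice made by [xget] is then forced; elsewhere
   [xget] may return the default value 0. *)
Definition csqrt x : A := xget 0 [set b | cpositive b /\ b ^+ 2 = x].

Definition cabs x : A := csqrt (star x * x).

Definition dotmeet a b : A := 2^-1 *: (a + b - cabs (a - b)).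

(* Meant for a and b between 0 and 1. *)
Definition absolutely_compatible a b : Prop :=
  cabs (a - b) + cabs (a + b - 1) = 1.

(* m is the greatest element of {x in S | x <= a, x <= b}. *)
Definition is_inf_in (S : set A) a b m : Prop :=
  [/\ S m, cle m a, cle m b &
      forall x, S x -> cle x a -> cle x b -> cle x m].

End CStarDefs.

(* Main.v *)
(* (2) implies (3) because [cabs] is self-adjoint.  From (1), with
   X = |a - p| and Y = |a + p - 1|, squaring Y = 1 - X gives X = a + p - ap - pa; comparing
   the p-corners of X^2 and (a - p)^2 yields (p a (1 - p)) (p a (1 - p))^* = 0.
   From (3), |a - p| = p (1 - a) + (1 - p) a by uniqueness of positive square roots.
   For the infimum, 0 <= x <= p forces x (1 - p) = 0.

   No functional calculus is used.  That the norm of a self-adjoint x is attained on its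
   spectrum follows from the Cayley transform: it gives 2 |z w| <= |z (1 + w)| for w = v^2,
   |v| <= 1, and iterating, 2^j |y^(2^j - 1) (1 - y)| <= |1 - y^(2^j)| for y = x^2,
   |x| <= 1; so 1 - y is not invertible when |x| = 1.  The same estimate gives the uniqueness
   of square roots.  An existence theorem for square roots is not needed. *)
Require Import Defs.
From mathcomp Require Import all_boot all_order all_algebra.
From mathcomp Require Import complex.
From mathcomp Require Import all_classical all_reals all_analysis.
From mathcomp Require Import ring lra.
From Stdlib Require Ncring Ncring_tac.
Import Order.TTheory GRing.Theory Num.Theory.
Import numFieldNormedType.Exports.
Local Open Scope classical_set_scope.
Local Open Scope ring_scope.

(** * Noncommutative ring identities *)

#[global] Instance nzRing_ops (B : nzRingType) :
  @Ncring.Ring_ops B 0 1 +%R *%R (fun x y => x - y) -%R eq := {}.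
#[global, refine] Instance nzRing_ncring (B : nzRingType) :
  Ncring.Ring (Ro := nzRing_ops B) := {}.
Proof.
- exact: add0r.
- exact: addrC.
- exact: addrA.
- exact: mul1r.
- exact: mulr1.
- exact: mulrA.
- exact: mulrDl.
- by move=> ? ? ?; exact: mulrDr.
- by [].
- exact: addrN.
Qed.

(** Closes identities valid in every unital ring; relations such as [p * p = p] must be rewritten
    separately. *)
Ltac nc_ring := Ncring_tac.non_commutative_ring.

(** * Norm and Neumann series *)

Section CStarTheory.
Context {R : realType} {A : cstarAlgType R[i]}.
Implicit Types (x y z a b p q e : A) (k l : R[i]) (s t : R).

(** [anorm] is valued in [R[i]]; this is the same number in [R], where [lra] and [nra] apply. *)
Definition nrm x : R := complex.Re (anorm x).

Lemma anorm_ge0 x : 0 <= anorm x.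
Proof.
have n0 : anorm (0 : A) = 0 by rewrite -(scale0r (0 : A)) anormZ normr0 mul0r.
have nN : anorm (- x) = anorm x by rewrite -scaleN1r anormZ normrN1 mul1r.
have := ler_anormD x (- x); rewrite subrr n0 nN -mulr2n.
by rewrite pmulrn_lge0.
Qed.

Lemma anormE x : anorm x = (nrm x)%:C%C.
Proof. by rewrite /nrm RRe_real// ger0_real// anorm_ge0. Qed.

Lemma nrm_ge0 x : 0 <= nrm x.
Proof. by have := anorm_ge0 x; rewrite anormE ler0c. Qed.

Lemma nrmD x y : nrm (x + y) <= nrm x + nrm y.
Proof. by rewrite -lecR rmorphD /= -!anormE; exact: ler_anormD. Qed.

Lemma nrmM x y : nrm (x * y) <= nrm x * nrm y.
Proof. by rewrite -lecR rmorphM /= -!anormE; exact: ler_anormM. Qed.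

Lemma normcC t : `|t%:C%C| = `|t|%:C%C :> R[i].
Proof. by rewrite normc_def /= expr0n addr0 sqrtr_sqr. Qed.

Lemma nrmZ k x : nrm (k *: x) = Normc.normc k * nrm x.
Proof.
apply/complexI; rewrite rmorphM /= -!anormE anormZ; congr (_ * _).
Qed.

Lemma nrmZr t x : nrm (t%:C%C *: x) = `|t| * nrm x.
Proof.
by apply/complexI; rewrite rmorphM /= -!anormE anormZ normcC.
Qed.

Lemma nrmN x : nrm (- x) = nrm x.
Proof. by rewrite /nrm -scaleN1r anormZ normrN1 mul1r. Qed.

Lemma nrmB x y : nrm (x - y) <= nrm x + nrm y.
Proof. by rewrite -(nrmN y) nrmD. Qed.

Lemma nrm0 : nrm 0 = 0.
Proof. by rewrite -(scale0r (0 : A)) nrmZ Normc.normc0 mul0r. Qed.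

Lemma nrm_eq0 x : nrm x = 0 -> x = 0.
Proof. by move=> x0; apply/anorm0_eq0; rewrite anormE x0. Qed.

Lemma nrm_le0 x : nrm x <= 0 -> x = 0.
Proof. by move=> x0; apply/nrm_eq0/le_anti; rewrite x0 nrm_ge0. Qed.

Lemma nrm_cstar x : nrm (star x * x) = nrm x ^+ 2.
Proof. by apply/complexI; rewrite rmorphXn /= -!anormE cstar_norm. Qed.

Lemma star0 : star (0 : A) = 0.
Proof. by apply: (addrI (star 0)); rewrite -starD !addr0. Qed.

Lemma starN x : star (- x) = - star x.
Proof. by apply/eqP; rewrite -addr_eq0 -starD addNr star0. Qed.

Lemma starB x y : star (x - y) = star x - star y.
Proof. by rewrite starD starN. Qed.

Lemma star1 : star (1 : A) = 1.
Proof.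
have : star (star 1 * 1) = 1 :> A by rewrite mulr1 starK.
by rewrite starM starK mulr1.
Qed.

Lemma starZr t x : star (t%:C%C *: x) = t%:C%C *: star x.
Proof. by rewrite starZ conj_Creal//; apply/complex_realP; exists t. Qed.

Lemma star_eq0 x : star x * x = 0 -> x = 0.
Proof.
move=> x0; have := nrm_cstar x; rewrite x0 nrm0 => /esym/eqP.
by rewrite expf_eq0 /= => /eqP; exact: nrm_eq0.
Qed.

Lemma nrm_star_le x : nrm x <= nrm (star x).
Proof.
have := nrm_ge0 x; rewrite le_eqVlt => /orP[/eqP<-|x0]; first exact: nrm_ge0.
by rewrite -(ler_pM2r x0) -expr2 -nrm_cstar nrmM.
Qed.

Lemma nrm_star x : nrm (star x) = nrm x.
Proof.
by apply/le_anti; rewrite nrm_star_le -{2}(starK x) nrm_star_le.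
Qed.

Lemma nrm1 : nrm 1 = 1.
Proof.
have := nrm_cstar 1; rewrite star1 mulr1 => /eqP.
rewrite expr2 -subr_eq0 -{1}[nrm 1]mulr1 -mulrBr mulf_eq0 => /orP[/eqP/nrm_eq0/eqP|].
  by rewrite oner_eq0.
by rewrite subr_eq0 => /eqP.
Qed.

Lemma nrmX_le1 x n : nrm x <= 1 -> nrm (x ^+ n) <= 1.
Proof.
move=> x1; elim: n => [|n IH]; first by rewrite expr0 nrm1.
rewrite exprS (le_trans (nrmM _ _))//.
by rewrite mulr_ile1// nrm_ge0.
Qed.

Lemma nrm_sa_sqr x : self_adjoint x -> nrm (x ^+ 2) = nrm x ^+ 2.
Proof. by move=> sx; rewrite -nrm_cstar sx expr2. Qed.

Lemma nrm_isometry x : star x * x = 1 -> nrm x = 1.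
Proof.
move=> ux; have := nrm_cstar x; rewrite ux nrm1 => /esym/eqP.
by rewrite sqrp_eq1 ?nrm_ge0// => /eqP.
Qed.

Lemma nrm_projection p : projection p -> nrm p <= 1.
Proof.
move=> [sp pp]; have := nrm_cstar p; rewrite sp pp => h.
by have := nrm_ge0 p; nra.
Qed.

(** Neumann series: the partial sums [u n] are Cauchy by the geometric tail bound [ud], and their
    limit is the inverse. *)
Lemma invertible_sub1 x : nrm x < 1 -> invertible (1 - x).
Proof.
move=> x1; pose u n : normed_of A := \sum_(i < n) x ^+ i.
have x0 := nrm_ge0 x.
have nX n : nrm (x ^+ n) <= nrm x ^+ n.
  elim: n => [|n IH]; first by rewrite !expr0 nrm1.
  by rewrite !exprS (le_trans (nrmM _ _))// ler_wpM2l.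
have ud n m : nrm ((u (n + m)%N : A) - u n) <= nrm x ^+ n * (1 - nrm x)^-1.
  rewrite /u big_split_ord /= addrAC subrr add0r.
  have -> : \sum_(i < m) x ^+ (n + i) = x ^+ n * \sum_(i < m) x ^+ i.
    by rewrite big_distrr /=; apply: eq_bigr => i _; rewrite exprD.
  rewrite (le_trans (nrmM _ _))// ler_pM ?nrm_ge0//.
  rewrite -[leRHS]mul1r ler_pdivlMr ?subr_gt0//.
  elim: m => [|m IH]; first by rewrite big_ord0 nrm0 mul0r.
  rewrite big_ord_recl expr0.
  have -> : \sum_(i < m) x ^+ (lift ord0 i) = x * \sum_(i < m) x ^+ i.
    by rewrite big_distrr /=; apply: eq_bigr => i _; rewrite exprS.
  have h1 := nrmD 1 (x * \sum_(i < m) x ^+ i).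
  have h2 := nrmM x (\sum_(i < m) x ^+ i).
  rewrite nrm1 in h1. 
  have := nrm_ge0 (\sum_(i < m) x ^+ i); nra.
have xn0 : nrm x ^+ n @[n --> \oo] --> (0 : R) by apply: cvg_expr; rewrite ger0_norm.
have small (eps : R) : 0 < eps -> exists n, nrm x ^+ n * (1 - nrm x)^-1 < eps.
  move=> e0; have e1 : 0 < eps * (1 - nrm x) by rewrite mulr_gt0// subr_gt0.
  have /cvgrPdist_lt/(_ _ e1) [N _ /(_ N (leqnn N))] := xn0.
  rewrite /= sub0r normrN ger0_norm ?exprn_ge0// => h.
  by exists N; rewrite ltr_pdivrMr ?subr_gt0.
have uc : cauchy (u n @[n --> \oo]).
  apply: cauchy_exP => /= eps e0.
  have er : eps = (complex.Re eps)%:C%C by rewrite RRe_real// gtr0_real.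
  move: e0; rewrite er ltcR => e0.
  have [N hN] := small _ e0.
  exists (u N); exists N => // n /= Nn; rewrite -ball_normE /=.
  rewrite -normrN opprB.
  have -> : `|u n - u N| = anorm ((u n : A) - u N) by [].
  by rewrite anormE ltcR -(subnKC Nn) (le_lt_trans (ud _ _)).
have /anorm_complete uL := uc.
have {}uL := uL _.
pose L : A := lim (u n @[n --> \oo]).
have hL (eps : R) : 0 < eps -> exists n, nrm (L - u n) < eps /\ nrm (x ^+ n) < eps.
  move=> e0.
  have e0' : 0 < eps%:C%C :> R[i] by rewrite ltcR.
  have /cvgrPdist_lt/(_ _ e0') [N _ hN] := uL.
  have /cvgrPdist_lt/(_ _ e0) [M _ hM] := xn0.
  exists (maxn N M); split.
    have := hN (maxn N M) (leq_maxl _ _) => /=.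
    have -> : `|lim (u n @[n --> \oo]) - u (maxn N M)| = anorm (L - u (maxn N M)) by [].
    by rewrite anormE ltcR.
  have := hM (maxn N M) (leq_maxr _ _) => /=.
  by rewrite sub0r normrN ger0_norm ?exprn_ge0//; apply: le_lt_trans.
(* Both defects [L (1 - x) - 1] and [(1 - x) L - 1] have one of these forms for every [n]. Since
   [|1 - x| <= 2], two error terms below [|z| / 4] give [|z| <= 3/4 |z|]. *)
have main (z : A) : (forall n, z = (1 - x) * (L - u n) - x ^+ n \/
    z = (L - u n) * (1 - x) - x ^+ n) -> z = 0.
  move=> hz; apply: nrm_le0; rewrite leNgt; apply/negP => z0.
  have [n [h1 h2]] := hL _ (divr_gt0 z0 (ltr0n _ 4) : 0 < nrm z / 4%:R).
  have h3 : nrm (1 - x) <= 2.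
    by rewrite (le_trans (nrmB _ _))// nrm1; lra.
  have h4 := nrm_ge0 (1 - x); have h5 := nrm_ge0 (L - u n).
  have h6 : nrm z <= nrm (1 - x) * nrm (L - u n) + nrm (x ^+ n).
    case: (hz n) => {1}->; rewrite (le_trans (nrmB _ _))// lerD2r.
      exact: nrmM.
    by rewrite mulrC nrmM.
  nra.
have gl n : (1 - x) * (u n : A) = 1 - x ^+ n.
  by rewrite -[RHS]opprB subrX1 -mulNr opprB.
have gr n : (u n : A) * (1 - x) = 1 - x ^+ n.
  rewrite -gl /u; apply/commr_sym.
  rewrite /GRing.comm big_distrl big_distrr /=; apply: eq_bigr => i _.
  by rewrite mulrBl mulrBr mul1r mulr1 -exprS -exprSr.
exists L; split; apply/eqP; rewrite -subr_eq0; apply/eqP/main => n.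
- by right; rewrite (mulrBl (1 - x)) gr opprB addrA [RHS]addrAC addrK.
- by left; rewrite (mulrBr (1 - x)) gl opprB addrA [RHS]addrAC addrK.
Qed.

(** * Spectrum and positivity *)

Lemma invertibleM x y : invertible x -> invertible y -> invertible (x * y).
Proof.
move=> [x' [h1 h2]] [y' [h3 h4]]; exists (y' * x'); split.
  by rewrite mulrA -(mulrA y') h1 mulr1.
by rewrite mulrA -(mulrA x) h4 mulr1.
Qed.

Lemma invertibleZ k x : k != 0 -> invertible x -> invertible (k *: x).
Proof.
move=> k0 [x' [h1 h2]]; exists (k^-1 *: x').
by rewrite -!scalerAl -!scalerAr !scalerA h1 h2 mulVf// mulfV// scale1r.
Qed.

Lemma invertibleN x : invertible x -> invertible (- x).
Proof. by move=> ix; rewrite -scaleN1r; apply: invertibleZ; rewrite ?oppr_eq0 ?oner_eq0. Qed.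

Lemma invertible0 : ~ invertible (0 : A).
Proof. by move=> [y [/eqP]]; rewrite mulr0 eq_sym oner_eq0. Qed.

Lemma invertible_scalar_sub k x : nrm x < Normc.normc k -> invertible (k%:A - x).
Proof.
move=> xk; have k0 : 0 < Normc.normc k by rewrite (le_lt_trans (nrm_ge0 x)).
have kn0 : k != 0 by apply: contraTneq k0 => ->; rewrite Normc.normc0 ltxx.
have -> : k%:A - x = k *: (1 - k^-1 *: x) by rewrite scalerBr scalerA mulfV// scale1r.
apply: invertibleZ => //; apply: invertible_sub1.
by rewrite nrmZ -(ltr_pM2l k0) mulrA -Normc.normcM mulfV// Normc.normc1 mulr1 mul1r.
Qed.

Lemma ImI : complex.Im ('i : R[i]) = 1.
Proof. by rewrite -complexiE. Qed.

(** Adding [i t] to both [k] and [x] leaves [k - x] unchanged, while the C*-identity gives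
    [|x + i t|^2 = |x^2 + t^2| <= |x|^2 + t^2], which is below [|k + i t|^2] for a suitable real
    [t]. *)
Lemma sa_invertible_sub k x :
  self_adjoint x -> complex.Im k != 0 -> invertible (k%:A - x).
Proof.
move=> sx; case: k => u v /= v0.
(* This makes [2 v t = n^2 + 1] for either sign of [v], so [|k + i t|^2 >= n^2 + 1 + t^2]. *)
pose n := nrm x; pose t := (n ^+ 2 + 1) / (2 * v).
have iE : 'i * t%:C%C = (0 +i* t)%C :> R[i].
  by rewrite -complexiE; apply/eqP; rewrite eq_complex /=; apply/andP; split; apply/eqP; ring.
have -> : (u +i* v)%C%:A - x = (u +i* (v + t))%C%:A - (x + ('i * t%:C%C)%:A).
  have -> : (u +i* (v + t))%C = (u +i* v)%C + 'i * t%:C%C.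
    by rewrite iE; apply/eqP; rewrite eq_complex /= addr0 !eqxx.
  by rewrite scalerDl opprD addrACA subrr addr0.
apply: invertible_scalar_sub => /=.
have nn : 0 <= nrm (x + ('i * t%:C%C)%:A) by exact: nrm_ge0.
rewrite -(@ltr_pXn2r _ 2)// ?nnegrE ?sqrtr_ge0// sqr_sqrtr ?addr_ge0 ?sqr_ge0//.
have -> : nrm (x + ('i * t%:C%C)%:A) ^+ 2 = nrm (x * x + (t ^+ 2)%:C%C%:A).
  rewrite -nrm_cstar; congr nrm.
  rewrite starD sx starZ star1 rmorphM /= conjCi.
  have -> : (t%:C%C)^* = t%:C%C :> R[i] by rewrite conj_Creal//; apply/complex_realP; exists t.
  rewrite mulNr scaleNr; set c := _%:A.
  have -> : (x - c) * (x + c) = x * x + (x * c - c * x) - c * c by nc_ring.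
  rewrite /c mulr_algl mulr_algr subrr addr0; congr (_ + _).
  rewrite mulr_algl scalerA mulrACA -expr2 sqrCi mulN1r scaleNr opprK -expr2.
  by rewrite rmorphXn.
apply: le_lt_trans (nrmD _ _) _.
rewrite nrmZr nrm1 mulr1 ger0_norm ?sqr_ge0//.
have h1 := nrmM x x; rewrite -/n -expr2 in h1.
have ht : 2 * v * t = n ^+ 2 + 1 by rewrite /t; field.
have := sqr_ge0 u; have := sqr_ge0 v; have := sqr_ge0 t.
rewrite sqrrD; lra.
Qed.

Lemma sa_spectrum x k : self_adjoint x -> spectrum x k ->
  exists2 t, k = t%:C%C & `|t| <= nrm x.
Proof.
move=> sx kx.
have k0 : complex.Im k = 0.
  by apply/eqP; apply: contrapT => /negP k0; apply: kx; exact: sa_invertible_sub.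
exists (complex.Re k); first by case: k k0 {kx} => ? ? /= ->.
rewrite leNgt; apply/negP => h; apply: kx; apply: invertible_scalar_sub.
by case: k k0 h => u v /= ->; rewrite expr0n addr0 sqrtr_sqr.
Qed.

(* [2 v b = - Im c] for the unitary Cayley transform [c = (1 - i v) (1 + i v)^-1]
   and [b = (1 + v^2)^-1]. *)
Lemma sa_cayley v : self_adjoint v ->
  exists b, [/\ b * (1 + v ^+ 2) = 1, (1 + v ^+ 2) * b = 1 &
                nrm (v * b) <= 2^-1].
Proof.
move=> sv; pose w : A := ('i : R[i]) *: v.
have sw : star w = - w by rewrite /w starZ conjCi sv scaleNr.
have ww : w * w = - (v * v).
  by rewrite /w -scalerAl -scalerAr scalerA -expr2 sqrCi scaleN1r.
have [g [gP Pg]] : invertible (1 + w).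
  have -> : 1 + w = - 'i *: ('i%:A - v).
    by rewrite scalerBr scalerA mulNr -expr2 sqrCi opprK scale1r scaleNr opprK.
  apply: invertibleZ; first by rewrite oppr_eq0 neq0Ci.
  by apply: sa_invertible_sub => //; rewrite ImI oner_eq0.
pose h := star g.
have Mh : (1 - w) * h = 1 by rewrite /h -sw -{1}star1 -starD -starM gP star1.
have hM : h * (1 - w) = 1 by rewrite /h -sw -{1}star1 -starD -starM Pg star1.
have cE : (1 - w) * g = g + g - 1.
  have -> : (1 - w) * g = g + g - (1 + w) * g by nc_ring.
  by rewrite Pg.
have c1 : nrm (g + g - 1) = 1.
  rewrite -cE; apply: nrm_isometry; rewrite starM starB star1 sw opprK -/h.
  have -> : h * (1 + w) * ((1 - w) * g) = h * (1 - w) * ((1 + w) * g) by nc_ring.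
  by rewrite hM Pg mulr1.
(* The unitary [c = g + g - 1] satisfies [c - star c = 2 (g - h)], of norm at most 2. Below,
   [g - h = - 2 w g h] turns this into the bound on [v g h]. *)
have gh : nrm (g - h) <= 1.
  have := nrmB (g + g - 1) (star (g + g - 1)).
  rewrite nrm_star c1 starB starD star1 -/h.
  have -> : g + g - 1 - (h + h - 1) = (2 : R)%:C%C *: (g - h).
    by rewrite rmorphD /= scalerDl scale1r; nc_ring.
  by rewrite nrmZr ger0_norm// => ?; lra.
have wg : w * g = g * w.
  have : g * ((1 + w) * w) * g = g * (w * (1 + w)) * g by congr (_ * _ * _); nc_ring.
  by rewrite !mulrA gP mul1r -!mulrA Pg mulr1.
exists (g * h); split.
- have -> : 1 + v ^+ 2 = (1 - w) * (1 + w).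
    by rewrite -[v ^+ 2]opprK expr2 -ww; nc_ring.
  by rewrite mulrA -(mulrA g) hM mulr1.
- have -> : 1 + v ^+ 2 = (1 - w) * (1 + w).
    by rewrite -[v ^+ 2]opprK expr2 -ww; nc_ring.
  by rewrite mulrA -(mulrA (1 - w)) Pg mulr1.
- have E : g - h = - (2 : R)%:C%C *: (w * (g * h)).
    rewrite scaleNr rmorphD /= scalerDl scale1r mulrA wg.
    have -> : g - h = g * ((1 - w) * h) - g * (1 + w) * h.
      by rewrite Mh gP mulr1 mul1r.
    nc_ring.
  have : nrm (v * (g * h)) = nrm (w * (g * h)).
    rewrite /w -scalerAl nrmZ -complexiE /= expr0n add0r expr1n sqrtr1 mul1r //.
  move=> ->; move: gh; rewrite E scaleNr nrmN nrmZr ger0_norm//; lra.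
Qed.

(** With [b] the inverse of [1 + v^2], [z v^2 = z (1 + v^2) (v b v)] and
    [|v b v| <= |v b| |v| <= 1/2]. *)
Lemma nrm_mul_sqr_le z v : self_adjoint v -> nrm v <= 1 ->
  2 * nrm (z * v ^+ 2) <= nrm (z * (1 + v ^+ 2)).
Proof.
move=> sv v1; have [b [b1 b2 b3]] := sa_cayley _ sv.
have bv : b * v = v * b.
  have : b * ((1 + v ^+ 2) * v) * b = b * (v * (1 + v ^+ 2)) * b.
    by congr (_ * _ * _); rewrite expr2; nc_ring.
  by rewrite !mulrA b1 mul1r -!mulrA b2 mulr1.
have -> : z * v ^+ 2 = z * (1 + v ^+ 2) * (v * b * v).
  by rewrite -bv -(mulrA b) -expr2 mulrA -(mulrA z) b2 mulr1.
have h1 := nrmM (z * (1 + v ^+ 2)) (v * b * v).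
have h2 := nrmM (v * b) v.
have := nrm_ge0 (z * (1 + v ^+ 2)); have := nrm_ge0 v; have := nrm_ge0 (v * b).
have h3 : nrm (v * b) * nrm v <= 2^-1 by have := nrm_ge0 v; have := nrm_ge0 (v * b); nra.
nra.
Qed.

Lemma self_adjointX x n : self_adjoint x -> self_adjoint (x ^+ n).
Proof.
move=> sx; rewrite /self_adjoint; elim: n => [|n IH]; first by rewrite expr0 star1.
by rewrite exprS starM IH sx -exprSr exprS.
Qed.

(** With [y = x^2] and [N = 2^j], factor [1 - y^(2N) = (1 - y^N) (1 + y^N)]; [nrm_mul_sqr_le] for
    [v = x^N] gains a factor 2 and leaves [y^N], which is absorbed into [z]. Hence the induction
    over all [z]. *)
Lemma nrm_pow_telescope x j z : self_adjoint x -> nrm x <= 1 ->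
  (2 ^ j)%:R * nrm (z * (x ^+ 2) ^+ (2 ^ j).-1 * (1 - x ^+ 2))
  <= nrm (z * (1 - (x ^+ 2) ^+ (2 ^ j))).
Proof.
move=> sx x1; elim: j z => [|j IH] z; first by rewrite expn0 mul1r expr0 mulr1 expr1.
set y := x ^+ 2; set N := (2 ^ j)%N.
have N0 : (0 < N)%N by rewrite expn_gt0.
have yN : (x ^+ N) ^+ 2 = y ^+ N by rewrite -exprM mulnC exprM.
have N2 : (2 ^ j.+1)%N = (N + N)%N by rewrite expnS mul2n addnn.
have -> : z * (1 - y ^+ (2 ^ j.+1)) = z * (1 - y ^+ N) * (1 + (x ^+ N) ^+ 2).
  by rewrite yN N2 exprD; nc_ring.
apply: le_trans (nrm_mul_sqr_le (z * (1 - y ^+ N)) _ _ _); first last.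
- exact: nrmX_le1.
- exact: self_adjointX.
rewrite yN.
have -> : z * (1 - y ^+ N) * y ^+ N = z * y ^+ N * (1 - y ^+ N) by nc_ring.
have := IH (z * y ^+ N); rewrite -/y -/N.
have -> : z * y ^+ N * y ^+ N.-1 = z * y ^+ (2 ^ j.+1).-1.
  by rewrite -mulrA -exprD N2 -(subn1 (N + N)) -addnBA// subn1.
have -> : (2 ^ j.+1)%:R = N%:R + N%:R :> R by rewrite N2 natrD.
lra.
Qed.

Lemma invertible_rscalar_sub t x : nrm x < `|t| -> invertible (t%:C%C%:A - x).
Proof.
by move=> h; apply: invertible_scalar_sub; rewrite /= expr0n addr0 sqrtr_sqr.
Qed.

Lemma self_adjointB x y : self_adjoint x -> self_adjoint y -> self_adjoint (x - y).
Proof. by move=> sx sy; rewrite /self_adjoint starB sx sy. Qed.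

Lemma self_adjointN x : self_adjoint x -> self_adjoint (- x).
Proof. by move=> sx; rewrite /self_adjoint starN sx. Qed.

Lemma self_adjointZr t x : self_adjoint x -> self_adjoint (t%:C%C *: x).
Proof. by move=> sx; rewrite /self_adjoint starZr sx. Qed.

(** Otherwise [1 - x'^2], for [x' = x / |x|], has an inverse [g], and the telescoping estimate
    bounds every [2^j] by [2 |g|]. *)
Lemma sa_nrm_spectrum x : self_adjoint x ->
  spectrum x (nrm x)%:C%C \/ spectrum x (- nrm x)%:C%C.
Proof.
move=> sx; set M := nrm x.
have := nrm_ge0 x; rewrite -/M le_eqVlt => /orP[/eqP M0|M0].
  left; rewrite -M0 (nrm_eq0 _ (esym M0)) /spectrum /= scale0r subr0.
  exact: invertible0.
apply: contrapT => /not_orP[/contrapT i1 /contrapT i2].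
pose x' : A := (M^-1)%:C%C *: x.
have sx' : self_adjoint x' by exact: self_adjointZr.
have x'1 : nrm x' = 1 by rewrite nrmZr ger0_norm ?invr_ge0 ?ltW// mulVf// gt_eqF.
have MC : (M^-1)%:C%C * M%:C%C = 1 :> R[i] by rewrite -rmorphM mulVf ?gt_eqF.
have [g [_ yg]] : invertible (1 - x' ^+ 2).
  have -> : 1 - x' ^+ 2 = (1 - x') * (1 + x') by rewrite expr2; nc_ring.
  have MC0 : (M^-1)%:C%C != 0 :> R[i] by rewrite fmorph_eq0 invr_eq0 gt_eqF.
  apply: invertibleM.
    have -> : 1 - x' = (M^-1)%:C%C *: (M%:C%C%:A - x).
      by rewrite scalerBr scalerA MC scale1r.
    exact: invertibleZ.
  have -> : 1 + x' = (M^-1)%:C%C *: (- ((- M)%:C%C%:A - x)).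
    by rewrite opprB scalerBr rmorphN scaleNr scalerN opprK scalerA MC scale1r addrC.
  exact/invertibleZ/invertibleN.
have pow2 j : nrm (x' ^+ (2 ^ j)) = 1.
  elim: j => [|j IH]; first by rewrite expn0 expr1.
  by rewrite expnSr exprM nrm_sa_sqr ?IH ?expr1n//; exact: self_adjointX.
(* Since [n <= 2^n], the power [x'^(2^n)] of norm 1 is [x'^n] times a contraction. *)
have pow n : 1 <= nrm (x' ^+ n).
  rewrite -(pow2 n) -(subnKC (ltnW (ltn_expl n (ltnSn 1)))) exprD.
  rewrite (le_trans (nrmM _ _))// -[leRHS]mulr1 ler_wpM2l ?nrm_ge0//.
  by rewrite nrmX_le1// x'1.
have bound j : (2 ^ j)%:R <= 2 * nrm g.
  have x'le : nrm x' <= 1 by rewrite x'1.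
  have h1 := nrm_pow_telescope _ j 1 sx' x'le.
  rewrite !mul1r in h1.
  set P := (x' ^+ 2) ^+ (2 ^ j).-1 in h1.
  have h2 : 1 <= nrm P by rewrite /P -exprM pow.
  have h3 : nrm P <= nrm (P * (1 - x' ^+ 2)) * nrm g.
    by have := nrmM (P * (1 - x' ^+ 2)) g; rewrite -mulrA yg mulr1.
  have h4 : nrm (1 - (x' ^+ 2) ^+ (2 ^ j)) <= 2.
    rewrite (le_trans (nrmB _ _))// nrm1 -exprM.
    have : nrm (x' ^+ (2 * 2 ^ j)) <= 1 by rewrite nrmX_le1// x'1.
    lra.
  have g0 := nrm_ge0 g; have n0 : 0 <= (2 ^ j)%:R :> R by [].
  have h5 := le_trans h1 h4.
  have h6 := le_trans h2 h3.
  apply: (@le_trans _ _ ((2 ^ j)%:R * (nrm (P * (1 - x' ^+ 2)) * nrm g))).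
    by rewrite -[leLHS]mulr1 ler_wpM2l.
  by rewrite mulrA ler_wpM2r.
have := bound (Num.bound (2 * nrm g)); apply/negP; rewrite -ltNge.
have g2 : 0 <= 2 * nrm g by rewrite mulr_ge0// nrm_ge0.
apply: lt_le_trans (archi_boundP g2) _.
by rewrite ler_nat ltnW// ltn_expl.
Qed.

Lemma sa_nrm_le x s : self_adjoint x ->
  (forall t, spectrum x t%:C%C -> `|t| <= s) -> nrm x <= s.
Proof.
move=> sx h; case: (sa_nrm_spectrum _ sx) => /h; rewrite ?normrN;
by rewrite ger0_norm ?nrm_ge0.
Qed.

Lemma spectrum_scalar_sub k l x : spectrum (k%:A - x) l -> spectrum x (k - l).
Proof.
move=> h i; apply: h.
have -> : l%:A - (k%:A - x) = - ((k - l)%:A - x).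
  by rewrite scalerBl; nc_ring.
exact: invertibleN.
Qed.

Lemma cpositive_sa x : cpositive x -> self_adjoint x.
Proof. by case. Qed.

Lemma cpositiveE x : self_adjoint x ->
  cpositive x <-> (forall t, spectrum x t%:C%C -> 0 <= t).
Proof.
move=> sx; split=> [[_ h] t /h|h]; first by rewrite ler0c.
by split=> // k kx; have [t kt _] := sa_spectrum _ _ sx kx; rewrite kt ler0c h -?kt.
Qed.

Lemma rscalar_sa t : self_adjoint (t%:C%C%:A : A).
Proof. exact/self_adjointZr/star1. Qed.

(** The spectrum of [x] lies in [[0, s]], hence so does that of [s - x]. Together with the converse
    below, this trades positivity for a norm bound. *)
Lemma cpositive_nrm_sub x s :
  cpositive x -> nrm x <= s -> nrm (s%:C%C%:A - x) <= s.
Proof.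
move=> px xs; have sx := cpositive_sa _ px.
apply: sa_nrm_le => [|t]; first exact: self_adjointB (rscalar_sa _) sx.
move=> /spectrum_scalar_sub; rewrite -rmorphB => h.
have h1 := (cpositiveE _ sx).1 px _ h.
have [t' /complexI <- h2] := sa_spectrum _ _ sx h.
move: h2; rewrite ger0_norm// => h2; rewrite ler_norml; lra.
Qed.

Lemma cpositive_of_nrm_sub x s :
  self_adjoint x -> nrm (s%:C%C%:A - x) <= s -> cpositive x.
Proof.
move=> sx h; apply/cpositiveE => // t tx; rewrite leNgt; apply/negP => t0.
apply: tx; have -> : t%:C%C%:A - x = - ((s - t)%:C%C%:A - (s%:C%C%:A - x)).
  by rewrite rmorphB scalerBl; nc_ring.
apply/invertibleN/invertible_rscalar_sub; apply: le_lt_trans h _.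
by rewrite (lt_le_trans _ (ler_norm _))//; lra.
Qed.

Lemma cpositive_anti x : cpositive x -> cpositive (- x) -> x = 0.
Proof.
move=> px pNx; apply: nrm_le0; have sx := cpositive_sa _ px.
apply: sa_nrm_le => // t tx; have t0 := (cpositiveE _ sx).1 px _ tx.
suff : 0 <= - t by rewrite ger0_norm//; lra.
apply: (cpositiveE _ (cpositive_sa _ pNx)).1 => // i; apply: tx.
have -> : t%:C%C%:A - x = - ((- t)%:C%C%:A - - x).
  by rewrite rmorphN scaleNr; nc_ring.
exact: invertibleN.
Qed.

(** For a complex root [r] of [k], [k - x^2 = (r - x) (r + x)], so [r] or [- r] is in the real
    spectrum of [x]. *)
Lemma cpositive_sqr x : self_adjoint x -> cpositive (x ^+ 2).
Proof.
move=> sx; split=> [|k kx]; first exact: self_adjointX.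
have [r rk] : exists r : R[i], r ^+ 2 = k by exists (sqrtC k); rewrite sqrtCK.
have : spectrum x r \/ spectrum x (- r).
  apply: contrapT => /not_orP[/contrapT i1 /contrapT i2]; apply: kx.
  have -> : k%:A - x ^+ 2 = (r%:A - x) * - ((- r)%:A - x).
    rewrite -rk scaleNr.
    have -> : (r ^+ 2)%:A = r%:A * r%:A :> A by rewrite mulr_algl scalerA expr2.
    set c : A := r%:A; have cx : c * x = x * c by rewrite mulr_algl mulr_algr.
    have -> : (c - x) * - (- c - x) = c * c - x * x + (c * x - x * c) by nc_ring.
    by rewrite cx subrr addr0 expr2.
  exact/invertibleM/invertibleN.
case=> /sa_spectrum => /(_ sx) [t rt _].
  by rewrite -rk rt -rmorphXn /= ler0c sqr_ge0.
by rewrite -rk -sqrrN rt -rmorphXn /= ler0c sqr_ge0.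
Qed.

Lemma nrm_le1 a : cpositive a -> cpositive (1 - a) -> nrm a <= 1.
Proof.
move=> pa pa1; have sa := cpositive_sa _ pa.
apply: sa_nrm_le => // t ta; have t0 := (cpositiveE _ sa).1 pa _ ta.
rewrite ger0_norm// -subr_ge0.
apply: (cpositiveE _ (cpositive_sa _ pa1)).1 => // i; apply: ta.
have -> : t%:C%C%:A - a = - ((1 - t)%:C%C%:A - (1 - a)).
  by rewrite rmorphB scalerBl scale1r; nc_ring.
exact: invertibleN.
Qed.

(** The inverses of [x] and [y] also commute with [e], so they can be glued blockwise. *)
Lemma invertible_corner e x y : e * e = e -> e * x = x * e -> e * y = y * e ->
  invertible x -> invertible y -> invertible (e * x + (1 - e) * y).
Proof.
move=> ee ex ey [x' [x'x xx']] [y' [y'y yy']].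
have comm z z' : e * z = z * e -> z' * z = 1 -> z * z' = 1 -> e * z' = z' * e.
  move=> ez h1 h2; have : z' * (z * e) * z' = z' * (e * z) * z' by rewrite ez.
  by rewrite !mulrA h1 mul1r -!mulrA h2 mulr1.
have ex' := comm _ _ ex x'x xx'; have ey' := comm _ _ ey y'y yy'.
have prod u u' v v' : e * u = u * e -> e * u' = u' * e -> e * v = v * e ->
    u' * u = 1 -> v' * v = 1 -> e * v' = v' * e ->
    (e * u' + (1 - e) * v') * (e * u + (1 - e) * v) = 1.
  move=> eu eu' ev h1 h2 ev'.
  have f0 : e * (1 - e) = 0 by rewrite mulrBr mulr1 ee subrr.
  have f0' : (1 - e) * e = 0 by rewrite mulrBl mul1r ee subrr.
  have fv : (1 - e) * v = v * (1 - e) by rewrite mulrBl mulrBr mul1r mulr1 ev.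
  have fv' : (1 - e) * v' = v' * (1 - e) by rewrite mulrBl mulrBr mul1r mulr1 ev'.
  rewrite eu' fv'.
  have -> : (u' * e + v' * (1 - e)) * (e * u + (1 - e) * v) =
      u' * e * (e * u) + u' * e * ((1 - e) * v) +
      (v' * (1 - e) * (e * u) + v' * (1 - e) * ((1 - e) * v)) by nc_ring.
  have -> : u' * e * (e * u) = (u' * u) * e.
    by rewrite -mulrA (mulrA e) ee eu mulrA.
  have -> : u' * e * ((1 - e) * v) = u' * (e * (1 - e)) * v by nc_ring.
  have -> : v' * (1 - e) * (e * u) = v' * ((1 - e) * e) * u by nc_ring.
  have -> : v' * (1 - e) * ((1 - e) * v) = v' * v * ((1 - e) * (1 - e)).
    by rewrite fv; rewrite !mulrA -(mulrA v') fv mulrA.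
  rewrite f0 f0' h1 h2 !mulr0 !mul0r mulrBr mulr1 f0'; nc_ring.
by exists (e * x' + (1 - e) * y'); split; apply: prod.
Qed.

(** Subtracting from a scalar acts blockwise, so the spectrum of the block sum lies in the union of
    the two spectra. *)
Lemma cpositive_corner e x y : projection e -> e * x = x * e -> e * y = y * e ->
  cpositive x -> cpositive y -> cpositive (e * x + (1 - e) * y).
Proof.
move=> [se ee] ex ey [sx px] [sy py]; split.
  rewrite /self_adjoint starD !starM starB star1 se sx sy ex.
  by rewrite mulrBr mulrBl mulr1 mul1r ey.
move=> k kz; apply: contrapT => k0; apply: kz.
have -> : k%:A - (e * x + (1 - e) * y) = e * (k%:A - x) + (1 - e) * (k%:A - y).
  by have H (c : A) : c - (e * x + (1 - e) * y) = e * (c - x) + (1 - e) * (c - y);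
    [nc_ring | exact: H].
apply: invertible_corner => //.
- by rewrite mulrBr mulrBl mulr_algl mulr_algr ex.
- by rewrite mulrBr mulrBl mulr_algl mulr_algr ey.
- by apply: contrapT => /px.
- by apply: contrapT => /py.
Qed.

Lemma cpositive0 : cpositive (0 : A).
Proof.
by have := cpositive_sqr _ star0; rewrite expr2 mulr0.
Qed.

Lemma cpositive_projection_mul p x :
  projection p -> p * x = x * p -> cpositive x -> cpositive (p * x).
Proof.
move=> hp px cx; rewrite -[p * x]addr0 -(mulr0 (1 - p)).
by apply: cpositive_corner cpositive0; rewrite // mulr0 mul0r.
Qed.

(** * Uniqueness of square roots *)

Lemma invertible_eq0 x y : invertible x -> x * y = 0 -> y = 0.
Proof. by move=> [x' [h _]] xy; rewrite -[y]mul1r -h -mulrA xy mulr0. Qed.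

(** From [2 g = 1 + v g] one gets [2 |g| <= 1 + |g|]. *)
Lemma inverse_two_sub v : nrm v <= 1 -> exists2 g : A, (1 + 1 - v) * g = 1 & nrm g <= 1.
Proof.
move=> v1; have [|g [gw wg]] := invertible_rscalar_sub 2 v.
  by rewrite ger0_norm//; lra.
have E : (2 : R)%:C%C%:A = 1 + 1 :> A by rewrite rmorphD /= scalerDl scale1r.
rewrite E in gw wg; exists g => //.
have : nrm (g + g) <= 1 + nrm v * nrm g.
  have -> : g + g = 1 + v * g by rewrite -{1}wg; nc_ring.
  by rewrite (le_trans (nrmD _ _))// nrm1 lerD2l nrmM.
have -> : g + g = (2 : R)%:C%C *: g by rewrite -mulr_algl E mulrDl mul1r.
rewrite nrmZr ger0_norm//; have := nrm_ge0 g; nra.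
Qed.

(* With [u = 1 - b/t] and [w = 1 + c/t] one gets [u d = d w], hence
   [d = u^n d w^-n] with [w^-1] contractive, whereas [u^n (1 - u^2)] tends to 0. *)
Lemma sylvester_mul_eq0 b c d : cpositive b -> cpositive c ->
  b * d = - (d * c) -> b * d = 0.
Proof.
move=> pb pc bd; pose t := nrm b + nrm c + 1.
have b0 := nrm_ge0 b; have c0 := nrm_ge0 c.
have t0 : 0 < t by rewrite /t; lra.
have tC : (t^-1)%:C%C * t%:C%C = 1 :> R[i] by rewrite -rmorphM mulVf ?gt_eqF.
have contract x : cpositive x -> nrm x <= t -> nrm (1 - (t^-1)%:C%C *: x) <= 1.
  move=> px xt; have -> : 1 - (t^-1)%:C%C *: x = (t^-1)%:C%C *: (t%:C%C%:A - x).
    by rewrite scalerBr scalerA tC scale1r.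
  rewrite nrmZr ger0_norm ?invr_ge0 ?(ltW t0)// mulrC ler_pdivrMr// mul1r.
  exact: cpositive_nrm_sub.
pose b' : A := (t^-1)%:C%C *: b; pose c' : A := (t^-1)%:C%C *: c.
have b'd : b' * d = - (d * c') by rewrite /b' /c' -scalerAl -scalerAr bd scalerN.
pose u := 1 - b'; pose v := 1 - c'.
have u1 : nrm u <= 1 by apply: contract => //; rewrite /t; lra.
have v1 : nrm v <= 1 by apply: contract => //; rewrite /t; lra.
have su : self_adjoint u.
  by apply: self_adjointB; [exact: star1 | exact/self_adjointZr/cpositive_sa].
have [g wg g1] := inverse_two_sub _ v1.
have udg : u * d * g = d.
  have -> : u * d * g = d * ((1 + 1 - v) * g).
    have -> : u * d * g = (d - b' * d) * g by rewrite /u; nc_ring.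
    by rewrite b'd /v; nc_ring.
  by rewrite wg mulr1.
have udgn n : u ^+ n * d * g ^+ n = d.
  elim: n => [|n IH]; first by rewrite !expr0 mul1r mulr1.
  have -> : u ^+ n.+1 * d * g ^+ n.+1 = u ^+ n * (u * d * g) * g ^+ n.
    by rewrite exprSr exprS; nc_ring.
  by rewrite udg.
(* Inserting [d = u^(2n) d g^(2n)], with [n = 2^j - 1], produces the factor [y^n (1 - y)] controlled
   by [nrm_pow_telescope]. *)
have small j : (2 ^ j)%:R * nrm ((1 - u ^+ 2) * d) <= 2 * nrm d.
  set n := (2 ^ j).-1; set y := u ^+ 2.
  have -> : (1 - y) * d = y ^+ n * (1 - y) * d * g ^+ (2 * n).
    have -> : y ^+ n * (1 - y) * d * g ^+ (2 * n) = (1 - y) * (y ^+ n * d * g ^+ (2 * n)).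
      have yn : y ^+ n * y = y * y ^+ n by rewrite -exprS exprSr.
      by rewrite mulrBr mulr1 yn; nc_ring.
    by rewrite -exprM udgn.
  have h1 := nrm_pow_telescope _ j 1 su u1; rewrite !mul1r -/y -/n in h1.
  have h2 : nrm (1 - y ^+ (2 ^ j)) <= 2.
    rewrite (le_trans (nrmB _ _))// nrm1 -exprM.
    have := nrmX_le1 u (2 * 2 ^ j) u1; lra.
  have h3 := nrmX_le1 g (2 * n) g1.
  have h4 : nrm (y ^+ n * (1 - y) * d * g ^+ (2 * n)) <= nrm (y ^+ n * (1 - y)) * nrm d.
    apply: (le_trans (nrmM _ _)); rewrite -[leRHS]mulr1.
    by apply: ler_pM; rewrite ?nrm_ge0// nrmM.
  apply: (@le_trans _ _ ((2 ^ j)%:R * (nrm (y ^+ n * (1 - y)) * nrm d))).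
    by rewrite ler_wpM2l.
  by rewrite mulrA ler_wpM2r ?nrm_ge0// (le_trans h1).
have yd : (1 - u ^+ 2) * d = 0.
  apply: nrm_le0; rewrite leNgt; apply/negP => e0.
  have d0 := nrm_ge0 d.
  set e := nrm ((1 - u ^+ 2) * d) in e0 small.
  have q0 : 0 <= 2 * nrm d / e by rewrite divr_ge0 ?mulr_ge0// ltW.
  have := small (Num.bound (2 * nrm d / e)); apply/negP; rewrite -ltNge.
  rewrite -ltr_pdivrMr//; apply: lt_le_trans (archi_boundP q0) _.
  by rewrite ler_nat ltnW// ltn_expl.
(* [1 - u^2 = (2 - b') b'], and [2 - b'] is invertible because [|b'| < 2]. *)
have b'd0 : b' * d = 0.
  have [g' _ _] := inverse_two_sub _ u1.
  apply: (invertible_eq0 (1 + 1 - b') _); last by rewrite -yd /u expr2; nc_ring.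
  have -> : 1 + 1 - b' = (2 : R)%:C%C%:A - b' by rewrite rmorphD /= scalerDl scale1r.
  apply: invertible_rscalar_sub; rewrite ger0_norm//.
  rewrite nrmZr ger0_norm ?invr_ge0 ?(ltW t0)// mulrC ltr_pdivrMr// /t; lra.
by move/eqP: b'd0; rewrite -scalerAl scaler_eq0 fmorph_eq0 invr_eq0 gt_eqF//= => /eqP.
Qed.

(** For [d = b - c], equality of the squares gives [b d = - d c], so [b d = 0]; symmetrically
    [c d = 0], whence [d^2 = 0]. *)
Lemma cpositive_sqr_inj b c : cpositive b -> cpositive c -> b ^+ 2 = c ^+ 2 -> b = c.
Proof.
move=> pb pc; rewrite !expr2 => bc.
have d1 : b * (b - c) = 0.
  apply: (sylvester_mul_eq0 _ _ _ pb pc).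
  have -> : b * (b - c) = b * b - c * c - (b - c) * c by nc_ring.
  by rewrite bc subrr sub0r.
have d2 : c * (c - b) = 0.
  apply: (sylvester_mul_eq0 _ _ _ pc pb).
  have -> : c * (c - b) = c * c - b * b - (c - b) * b by nc_ring.
  by rewrite bc subrr sub0r.
apply/eqP; rewrite -subr_eq0; apply/eqP/star_eq0.
rewrite starB (cpositive_sa _ pb) (cpositive_sa _ pc).
have -> : (b - c) * (b - c) = b * (b - c) + c * (c - b) by nc_ring.
by rewrite d1 d2 addr0.
Qed.

Lemma csqrt_sqr c : cpositive c -> csqrt (c ^+ 2) = c :> A.
Proof.
by move=> pc; apply: xget_unique => // b [pb bc]; exact: cpositive_sqr_inj.
Qed.

(** The second alternative is the default value of [xget]; carrying it along replaces an existence
    theorem for square roots. *)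
Lemma csqrt_cases x : cpositive (csqrt x : A) /\ csqrt x ^+ 2 = x \/ csqrt x = 0 :> A.
Proof. by rewrite /csqrt; case: xgetP => [y _ []|_]; [left | right]. Qed.

Lemma cabs_cases x : self_adjoint x ->
  cpositive (cabs x) /\ cabs x * cabs x = x * x \/ cabs x = 0.
Proof.
by move=> sx; rewrite /cabs sx; have := csqrt_cases (x * x); rewrite expr2.
Qed.

Lemma cabs_sa x : self_adjoint (cabs x).
Proof.
by rewrite /cabs; case: (csqrt_cases (star x * x)) => [[[]]|->] //; exact: star0.
Qed.

(** * Projections *)

Lemma projectionC p : projection p -> projection (1 - p).
Proof.
move=> [sp pp]; split; first exact: self_adjointB star1 sp.
have -> : (1 - p) * (1 - p) = 1 - p + (p * p - p) by nc_ring.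
by rewrite pp subrr addr0.
Qed.

(** Corner version of [cpositive_of_nrm_sub], with [q] as unit: for [t < 0], [t + y] splits along
    [q] and [1 - q] into invertible blocks. *)
Lemma cpositiveN_corner y q s : projection q -> self_adjoint y -> q * y = y ->
  nrm (s%:C%C *: q + y) <= s -> cpositive (- y).
Proof.
move=> [sq qq] sy qy ns; have sNy := self_adjointN _ sy.
have yq : y * q = y by rewrite -[RHS]sy -[in RHS]qy starM sy sq.
apply/cpositiveE => // t ty; rewrite leNgt; apply/negP => t0; apply: ty.
pose S : A := s%:C%C%:A; pose T : A := t%:C%C%:A.
have SE z : s%:C%C *: z = S * z by rewrite /S mulr_algl.
have Sq z : S * z = z * S by rewrite /S mulr_algl mulr_algr.
have Tq z : T * z = z * T by rewrite /T mulr_algl mulr_algr.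
have -> : t%:C%C%:A - - y = - (q * ((s - t)%:C%C%:A - (s%:C%C *: q + y)) + (1 - q) * (- t)%:C%C%:A).
  rewrite SE rmorphB rmorphN scalerBl scaleNr -/S -/T.
  have H : - (q * (S - T - (S * q + y)) + (1 - q) * - T) =
      T + q * y - (S * q - S * (q * q)) + (S * q - q * S) + (q * S * q - S * q * q) by nc_ring.
  by rewrite opprK H qy qq subrr subr0 !Sq !subrr !addr0.
apply: invertibleN; apply: invertible_corner => //.
- rewrite mulrBr mulrBl mulr_algr mulr_algl mulrDr mulrDl.
  by rewrite -scalerAr -scalerAl qy yq.
- by rewrite mulr_algl mulr_algr.
- apply: invertible_rscalar_sub; apply: le_lt_trans ns _.
  by rewrite (lt_le_trans _ (ler_norm _))//; lra.
- rewrite -[X in invertible X]subr0.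
  apply: invertible_rscalar_sub; by rewrite nrm0 normrN normr_gt0 lt_eqF.
Qed.

(** It suffices that [h = star (x q) (x q)] vanishes, which follows once [h] and [- h] are both
    positive. For [h]: it is [q k^2], with [k^2] a positive element commuting with [q]. *)
Lemma cpositive_corner_eq0 x q :
  cpositive x -> projection q -> q * x * q = 0 -> x * q = 0.
Proof.
move=> px hq qxq; have [sq qq] := hq; have sx := cpositive_sa _ px.
pose k := x * q + q * x; pose h := q * x * x * q.
have sk : self_adjoint k.
  by rewrite /self_adjoint /k starD !starM sx sq addrC.
have k2 : k ^+ 2 = x * q * x + h.
  have -> : k ^+ 2 = x * (q * x * q) + x * (q * q) * x + h + (q * x * q) * x.
    by rewrite expr2 /k /h; nc_ring.
  by rewrite qxq qq mulr0 mul0r add0r addr0.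
have qk : q * k ^+ 2 = h.
  have -> : q * k ^+ 2 = q * x * q * x + (q * q) * x * x * q.
    by rewrite k2 /h; nc_ring.
  by rewrite qxq qq mul0r add0r.
have kq : k ^+ 2 * q = h.
  have -> : k ^+ 2 * q = x * (q * x * q) + q * x * x * (q * q).
    by rewrite k2 /h; nc_ring.
  by rewrite qxq qq mulr0 add0r.
have ph : cpositive h.
  by rewrite -qk; apply: cpositive_projection_mul (cpositive_sqr _ sk); rewrite ?qk ?kq.
have h0 : h = 0.
  apply: cpositive_anti => //; pose t := nrm x; pose T : A := t%:C%C%:A.
  have TE z : t%:C%C *: z = T * z by rewrite /T mulr_algl.
  have Tz z : T * z = z * T by rewrite /T mulr_algl mulr_algr.
  apply: (cpositiveN_corner h q (t ^+ 2)) => //; first exact: cpositive_sa.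
    by rewrite /h !mulrA qq.
  have sT : star T = T by exact: rscalar_sa.
  (* For [- h]: as [q x q = 0], compressing [(t - x)^2] by [q] gives exactly [t^2 q + h], of norm at
     most [t^2]. *)
  have -> : (t ^+ 2)%:C%C *: q + h = star ((T - x) * q) * ((T - x) * q).
    rewrite starM starB sT sx sq rmorphXn expr2 -scalerA !TE.
    have -> : q * (T - x) * ((T - x) * q) =
      q * T * T * q - q * T * (x * q) - q * x * (T * q) + h by rewrite /h; nc_ring.
    have -> : q * T * (x * q) = T * (q * x * q) by rewrite -(Tz q); nc_ring.
    have -> : q * x * (T * q) = (q * x * q) * T by rewrite (Tz q); nc_ring.
    rewrite qxq mulr0 mul0r !subr0 -(Tz q) -(mulrA T q T) -(Tz q).
    have -> : T * (T * q) * q = T * (T * (q * q)) by nc_ring.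
    by rewrite qq.
  rewrite nrm_cstar ler_pXn2r ?nnegrE ?nrm_ge0//.
  apply: (le_trans (nrmM _ _)); rewrite -[leRHS]mulr1.
  apply: ler_pM; rewrite ?nrm_ge0 ?nrm_projection//.
  exact: cpositive_nrm_sub.
by apply: star_eq0; rewrite starM sx sq mulrA -/h h0.
Qed.

(** Compression by [q = 1 - p] gives [0 <= q x q <= q p q = 0]. Both inequalities are obtained from
    norm bounds, since compression by [q] is contractive. *)
Lemma cpositive_le_projection x p :
  cpositive x -> projection p -> cpositive (p - x) -> x * (1 - p) = 0.
Proof.
move=> px hp ppx; have hq := projectionC _ hp.
set q := 1 - p in hq *; have [sq qq] := hq; have sx := cpositive_sa _ px.
have qp : q * p = 0 by rewrite /q mulrBl mul1r hp.2 subrr.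
apply: cpositive_corner_eq0 => //.
pose t := nrm x + nrm (p - x); have x0 := nrm_ge0 x; have x1 := nrm_ge0 (p - x).
pose T : A := t%:C%C%:A.
have TE z : t%:C%C *: z = T * z by rewrite /T mulr_algl.
have Tz z : T * z = z * T by rewrite /T mulr_algl mulr_algr.
have comp z : nrm z <= t -> nrm (q * z * q) <= t.
  move=> zt; apply: (le_trans (nrmM _ _)); have := nrmM q z.
  have := nrm_projection _ hq; have := nrm_ge0 q; have := nrm_ge0 z.
  have := nrm_ge0 (q * z); nra.
have sy : self_adjoint (q * x * q).
  by rewrite /self_adjoint !starM sx sq mulrA.
have qy : q * (q * x * q) = q * x * q by rewrite !mulrA qq.
apply: cpositive_anti.
- rewrite -[q * x * q]opprK; apply: (cpositiveN_corner _ q t) => //.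
  + exact: self_adjointN.
  + by rewrite mulrN qy.
  have -> : t%:C%C *: q - q * x * q = q * (T - x) * q.
    rewrite TE.
    have -> : q * (T - x) * q = q * T * q - q * x * q by nc_ring.
    by rewrite -Tz -(mulrA T) qq.
  by apply/comp/cpositive_nrm_sub => //; rewrite /t; lra.
- apply: (cpositiveN_corner _ q t) => //.
  have -> : t%:C%C *: q + q * x * q = q * (T - (p - x)) * q.
    rewrite TE.
    have -> : q * (T - (p - x)) * q = q * T * q - q * p * q + q * x * q by nc_ring.
    by rewrite -Tz -(mulrA T) qq qp mul0r subr0.
  by apply/comp/cpositive_nrm_sub => //; rewrite /t; lra.
Qed.

(* If [cabs] takes its default value 0 on one of [a - p], [a + p - 1], then absolute
   compatibility says that the other has square 1. *)
Lemma sqr_sub_projection_commute a q : cpositive a -> cpositive (1 - a) ->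
  projection q -> (a - q) * (a - q) = 1 -> a * q = q * a.
Proof.
move=> pa pa1 hq e1; have [sq qq] := hq; have sa := cpositive_sa _ pa.
have a1 := nrm_le1 _ pa pa1.
(* This element is [(2 - a) a]. Compressing [(a - q)^2 = 1] by [q] kills its [q]-corner, hence its
   product with [q]; cancelling [2 - a] leaves [a q = 0]. *)
have px : cpositive (1 - (1 - a) ^+ 2).
  have s1a := cpositive_sa _ pa1.
  apply: (cpositive_of_nrm_sub _ 1).
    by apply: self_adjointB; [exact: star1 | exact: self_adjointX].
  rewrite scale1r opprB addrC subrK nrmX_le1// nrm_le1//.
  by rewrite opprB addrC subrK.
have xq : (1 - (1 - a) ^+ 2) * q = 0.
  apply: cpositive_corner_eq0 => //.
  have : q * ((a - q) * (a - q)) * q = q * 1 * q by rewrite e1.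
  have -> : q * ((a - q) * (a - q)) * q =
    q * a * a * q - q * a * (q * q) - (q * q) * a * q + (q * q) * (q * q) by nc_ring.
  rewrite mulr1 !qq => /eqP; rewrite -subr_eq0 => /eqP h.
  have -> : q * (1 - (1 - a) ^+ 2) * q =
    - (q * a * a * q - q * a * q - q * a * q + q - q) by rewrite expr2; nc_ring.
  by rewrite h oppr0.
have aq : a * q = 0.
  apply: (invertible_eq0 (1 + 1 - a)); last by rewrite -xq expr2; nc_ring.
  have -> : 1 + 1 - a = (2 : R)%:C%C%:A - a by rewrite rmorphD /= scalerDl scale1r.
  by apply: invertible_rscalar_sub; rewrite ger0_norm//; lra.
by rewrite aq -[RHS]starK starM sa sq aq star0.
Qed.

(** * Equivalence of the three conditions, and the infimum *)

Lemma double_inj x y : x + x = y + y -> x = y.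
Proof.
rewrite -(mulr2n x) -(mulr2n y) -(scaler_nat 2 x) -(scaler_nat 2 y).
move=> /(congr1 (fun z => (2 : R[i])^-1 *: z)).
by rewrite !scalerA mulVf ?pnatr_eq0// !scale1r.
Qed.

Lemma absolutely_compatible_commute a p :
  cpositive a -> cpositive (1 - a) -> projection p ->
  absolutely_compatible a p -> a * p = p * a.
Proof.
move=> pa pa1 hp.
have [sp pp] := hp; have sa := cpositive_sa _ pa.
rewrite /absolutely_compatible.
have s1 : self_adjoint (a - p) by exact: self_adjointB.
have s2 : self_adjoint (a + p - 1).
  by rewrite /self_adjoint starB starD sa sp star1.
have hq := projectionC _ hp.
have aq : a * (1 - p) = (1 - p) * a -> a * p = p * a.
  by move=> h; rewrite -[p in LHS](subKr 1) mulrBr h mulrBl !mul1r mulr1 subKr.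
(* First the cases where a [cabs] is the default 0: both cannot be, and if one is, the other forces
   [(a - p)^2 = 1] or [(a - (1 - p))^2 = 1]. *)
case: (cabs_cases _ s2) => [[pY Y2]|Y0]; last first.
  case: (cabs_cases _ s1) => [[pX X2]|X0]; last first.
    by rewrite X0 Y0 addr0 => /esym/eqP; rewrite oner_eq0.
  rewrite Y0 addr0 => X1; apply: sqr_sub_projection_commute => //.
  by rewrite -X2 X1 mulr1.
case: (cabs_cases _ s1) => [[pX X2]|X0]; last first.
  rewrite X0 add0r => Y1; apply/aq/sqr_sub_projection_commute => //.
  have -> : a - (1 - p) = a + p - 1 by nc_ring.
  by rewrite -Y2 Y1 mulr1.
set X := cabs (a - p) in X2 *; set Y := cabs _ in Y2 * => XY.
(* Subtracting [Y^2 = (1 - X)^2] from [X^2] determines [X] linearly. *)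
have XE : X = a + p - a * p - p * a.
  have YE : Y = 1 - X by rewrite -XY; nc_ring.
  apply: double_inj.
  have -> : X + X = 1 + X * X - (1 - X) * (1 - X) by nc_ring.
  by rewrite -YE Y2 X2; nc_ring.
have pX' : p * X = p - p * a * p.
  have -> : p * X = p * a + p * p - p * a * p - p * p * a by rewrite XE; nc_ring.
  by rewrite pp; nc_ring.
have Xp : X * p = p - p * a * p.
  have -> : X * p = a * p + p * p - a * (p * p) - p * a * p by rewrite XE; nc_ring.
  by rewrite pp; nc_ring.
have w0 : (1 - p) * (a * p) = 0.
  (* Expanding both sides gives [p a p a p = p a a p], that is, [p a (1 - p) a p = 0]. *)
  have H : (p * X) * (X * p) = p * ((a - p) * (a - p)) * p by rewrite -X2 !mulrA.
  rewrite pX' Xp in H.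
  have L : (p - p * a * p) * (p - p * a * p) =
    p * p - p * p * (a * p) - p * a * (p * p) + p * a * (p * p) * (a * p) by nc_ring.
  have M : p * ((a - p) * (a - p)) * p =
    p * a * (a * p) - p * a * (p * p) - p * p * (a * p) + p * p * (p * p) by nc_ring.
  rewrite L M !pp in H.
  apply: star_eq0; rewrite !starM starB star1 sa sp.
  have -> : p * a * (1 - p) * ((1 - p) * (a * p)) = p * a * ((1 - p) * (1 - p)) * (a * p).
    by rewrite !mulrA.
  rewrite hq.2 mulrBr mulrBl mulr1.
  have -> : p * a * (a * p) - p * a * p * (a * p) =
    (p * a * (a * p) - p * a * p - p * (a * p) + p)
    - (p - p * (a * p) - p * a * p + p * a * p * (a * p)) by nc_ring.
  by rewrite H subrr.
move/eqP: w0; rewrite mulrBl mul1r subr_eq0 => /eqP apE.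
have := congr1 star apE; rewrite !starM sa sp => ->.
by rewrite apE mulrA.
Qed.

(** Blockwise, [a - p] is [a - 1 <= 0] on [p] and [a >= 0] on [1 - p]; the right side flips the
    first sign. *)
Lemma cabs_sub_projection a p : cpositive a -> cpositive (1 - a) -> projection p ->
  a * p = p * a -> cabs (a - p) = p * (1 - a) + (1 - p) * a.
Proof.
move=> pa pa1 hp ap; have [sp pp] := hp; have sa := cpositive_sa _ pa.
have pc : cpositive (p * (1 - a) + (1 - p) * a).
  by apply: cpositive_corner => //; rewrite mulrBr mulrBl mulr1 mul1r ap.
rewrite /cabs -[RHS]csqrt_sqr// starB sa sp; congr csqrt.
pose m := p * a.
have pm : p * m = m by rewrite /m mulrA pp.
have mp : m * p = m by rewrite /m -mulrA ap mulrA pp.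
have am : a * m = m * a by rewrite /m mulrA ap.
have mm : m * m = m * a by rewrite {2}/m mulrA mp.
have -> : p * (1 - a) + (1 - p) * a = p + a - m - m by rewrite /m; nc_ring.
have -> : (p + a - m - m) ^+ 2 = a * a + p * p + a * p + p * a - a * m - a * m
  - p * m - p * m - m * a - m * a - m * p - m * p + m * m + m * m + m * m + m * m.
  by rewrite expr2; nc_ring.
rewrite mm pm mp am ap -/m pp.
have -> : (a - p) * (a - p) = a * a - a * p - p * a + p * p by nc_ring.
by rewrite ap pp -/m; nc_ring.
Qed.

Lemma dotmeet_projection a p : cpositive a -> cpositive (1 - a) -> projection p ->
  a * p = p * a -> dotmeet a p = a * p.
Proof.
move=> pa pa1 hp ap; rewrite /dotmeet cabs_sub_projection//.
have -> : a + p - (p * (1 - a) + (1 - p) * a) = p * a + p * a by nc_ring.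
by rewrite -mulr2n -(scaler_nat 2 (p * a)) scalerA mulVf ?pnatr_eq0// scale1r ap.
Qed.

Lemma dotmeet_commute a p : self_adjoint a -> self_adjoint p ->
  dotmeet a p = a * p -> a * p = p * a.
Proof.
move=> sa sp h; rewrite -{1}h -[p]sp -[a]sa -starM sa sp -h /dotmeet starZ.
rewrite starB starD sa sp cabs_sa conj_Creal// ger0_real// invr_ge0 ler0n//.
Qed.

(** Since [a + p - 1 = a - (1 - p)], the formula for [cabs] applies to both [p] and [1 - p], and the
    blocks add up to 1. *)
Lemma commute_absolutely_compatible a p :
  cpositive a -> cpositive (1 - a) -> projection p ->
  a * p = p * a -> absolutely_compatible a p.
Proof.
move=> pa pa1 hp ap; rewrite /absolutely_compatible cabs_sub_projection//.
have -> : a + p - 1 = a - (1 - p) by nc_ring.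
rewrite cabs_sub_projection//; last by rewrite mulrBr mulrBl mulr1 mul1r ap.
  by nc_ring.
exact: projectionC.
Qed.

Lemma commute_is_inf a p : cpositive a -> cpositive (1 - a) -> projection p ->
  a * p = p * a -> is_inf_in cpositive a p (a * p).
Proof.
move=> pa pa1 hp ap; have hq := projectionC _ hp.
have sa := cpositive_sa _ pa.
have pap : cpositive (a * p) by rewrite ap; exact: cpositive_projection_mul.
have sap := cpositive_sa _ pap.
split=> //.
- split=> //; have -> : a - a * p = (1 - p) * a by rewrite ap; nc_ring.
  by apply: cpositive_projection_mul => //; rewrite mulrBr mulrBl mulr1 mul1r ap.
- split=> //; first exact: hp.1.
  have -> : p - a * p = p * (1 - a) by rewrite ap; nc_ring.
  by apply: cpositive_projection_mul => //; rewrite mulrBr mulrBl mulr1 mul1r ap.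
- move=> x px [sx _ pax] [_ _ ppx]; split=> //.
  (* A lower bound [x] lives in the corner of [p], so [a p - x = p (a - x)] is a product of
     commuting positive elements, one of them a projection. *)
  have xp : x * p = x.
    have := cpositive_le_projection _ _ px hp ppx.
    by rewrite mulrBr mulr1 => /eqP; rewrite subr_eq0 => /eqP.
  have px' : p * x = x by rewrite -[RHS]sx -[in RHS]xp starM hp.1 sx.
  have -> : a * p - x = p * (a - x) by rewrite mulrBr px' ap.
  by apply: cpositive_projection_mul => //; rewrite mulrBr mulrBl ap px' xp.
Qed.

End CStarTheory.

Theorem proposition4p9 (R : realType) (A : cstarAlgType R[i]) (a p : A)
    (ha0 : cle 0 a) (ha1 : cle a 1) (hp : projection p) :
  [/\ absolutely_compatible a p <-> dotmeet a p = a * p,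
      dotmeet a p = a * p <-> a * p = p * a,
      absolutely_compatible a p <-> a * p = p * a
    & a * p = p * a -> is_inf_in cpositive a p (dotmeet a p)].
Proof.
have [_ _ pa] := ha0; have [_ _ pa1] := ha1; rewrite subr0 in pa.
have sa := cpositive_sa _ pa.
split.
- split=> [/absolutely_compatible_commute ap|/dotmeet_commute ap].
    by apply: dotmeet_projection => //; exact: ap.
  by apply: commute_absolutely_compatible => //; apply: ap => //; exact: hp.1.
- split=> [/dotmeet_commute|]; last exact: dotmeet_projection.
  by apply=> //; exact: hp.1.
- split; first exact: absolutely_compatible_commute.
  exact: commute_absolutely_compatible.
- by move=> ap; rewrite dotmeet_projection//; exact: commute_is_inf.
Qed.
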